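(* Let $k\ge 2$ and $n\ge 1$ be integers and let $A\subset [k]^n$. Then for any $\epsilon>0$, there is an $M$-junta $g:[k]^n\to\{0,1\}$ such that $\|1_A-g\|_1\le\epsilon$, where $$M\le \exp\!\left(\frac{C_1|\partial A|}{k^{n-1}\epsilon}\right)$$ and $C_1$ is an absolute constant.
   Context: $[k]=\{1,\dots,k\}$. The $\ell^1$-grid $G_{k,n}$ is the graph with vertex set $[k]^n$ in which $x,y$ are adjacent iff there is $j\in[n]$ with $|x_j-y_j|=1$ and $x_i=y_i$ for all $i\ne j$. For $A\subset[k]^n$, $\partial A$ is the edge-boundary of $A$ in $G_{k,n}$, i.e. the set of edges of $G_{k,n}$ joining a point of $A$ to a point of $[k]^n\setminus A$. $1_A$ is the indicator function of $A$. For $f:[k]^n\to\mathbb{R}$, $\|f\|_1=k^{-n}\sum_{x\in[k]^n}|f(x)|$. A function $g$ on $[k]^n$ is an $M$-junta if there is $J\subset[n]$ with $|J|=M$ such that $g(x)$ depends only on $(x_j)_{j\in J}$. *)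

(* Defs.v *)
From mathcomp Require Import all_boot all_order all_algebra.

Set Implicit Arguments.
Unset Strict Implicit.
Unset Printing Implicit Defensive.

Import GRing.Theory Num.Theory.
Local Open Scope ring_scope.

(* [k]^n, with the letters 1, ..., k renumbered 0, ..., k-1; the shift affects
   neither coordinate differences nor coordinate equality. *)
Notation grid k n := {ffun 'I_n -> 'I_k}.

Definition grid_adj (k n : nat) (x y : grid k n) : bool :=
  [exists j : 'I_n,
     (`|(x j : nat)%:Z - (y j : nat)%:Z| == 1)
     && [forall i : 'I_n, (i != j) ==> (x i == y i)]].

(* Undirected edges, each represented by the set of its two endpoints. *)
Definition grid_edges (k n : nat) : {set {set grid k n}} :=
  [set [set x; y] | x in grid k n, y in grid k n & grid_adj x y].

Definition edge_boundary (k n : nat) (A : {set grid k n}) :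
    {set {set grid k n}} :=
  [set e in grid_edges k n |
     [exists x in A, [exists y in ~: A, e == [set x; y]]]].

Definition l1norm (R : numFieldType) (k n : nat) (f : grid k n -> R) : R :=
  (k%:R ^+ n)^-1 * \sum_(x : grid k n) `|f x|.

Definition is_junta (k n : nat) (T : Type) (M : nat) (g : grid k n -> T) : Prop :=
  exists J : {set 'I_n},
    #|J| = M /\
    forall x y : grid k n, (forall j, j \in J -> x j = y j) -> g x = g y.

(* Main.v *)
Require Import Defs.
From mathcomp Require Import all_boot all_order all_algebra.
From mathcomp Require Import reals sequences exp.
From mathcomp Require Import ring lra zify.

(* Encode each letter of [k] by m bits, m large: an m-bit number v is sent to
   the letter min(v / q, k - 1) with q = floor(2^m / k), so that the uniform
   measure on the cube is pushed to a measure on [k]^n within a factor 2 of the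
   uniform one, and A is pulled back to a subset of the cube {0,1}^(nm).
   Flipping the bit of weight 2^b moves v by 2^b, so it crosses a given
   threshold with probability at most 2^(b+1-m); these sum to at most 2 over b,
   whence the total influence of the pullback is O(|dA| / k^(n-1)) uniformly in
   k. Friedgut's argument (the level inequality from Bonami's (2,4)-bound) then
   gives few bits carrying all but little of the Fourier mass. Let J be the
   coordinates of [k]^n these bits belong to: resampling the coordinates
   outside J rarely changes membership in A, first for the pushed measure and
   then for the uniform one, and fixing the best value of the resampled
   coordinates gives the junta. *)

Set Implicit Arguments.
Unset Strict Implicit.
Unset Printing Implicit Defensive.

Import GRing.Theory Num.Theory.
Import Order.TTheory.
Local Open Scope ring_scope.

(** * Fourier analysis on the cube *)

Section Cube.
Variables (R : realFieldType) (I : finType).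
Implicit Types (S T X Y J V : {set I}) (f g : {set I} -> R) (i : I).

(* A point of the cube is identified with the set of its nonzero bits. *)
Definition mean f : R := (2 ^+ #|I|)^-1 * \sum_X f X.

Lemma eq_mean f g : f =1 g -> mean f = mean g.
Proof. by move=> fg; congr (_ * _); apply: eq_bigr. Qed.

Lemma meanD f g : mean (fun X => f X + g X) = mean f + mean g.
Proof. by rewrite /mean big_split mulrDr. Qed.

Lemma meanZ a f : mean (fun X => a * f X) = a * mean f.
Proof. by rewrite /mean -mulr_sumr mulrCA. Qed.

Lemma meanZr a f : mean (fun X => f X * a) = mean f * a.
Proof. by rewrite /mean -mulr_suml mulrA. Qed.

Lemma meanB f g : mean (fun X => f X - g X) = mean f - mean g.
Proof. by rewrite /mean sumrB mulrBr. Qed.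

Lemma mean_sum (K : finType) (P : pred K) (F : K -> {set I} -> R) :
  mean (fun X => \sum_(s | P s) F s X) = \sum_(s | P s) mean (F s).
Proof. by rewrite /mean exchange_big mulr_sumr. Qed.

Lemma mean_cst a : mean (fun=> a) = a.
Proof.
rewrite /mean sumr_const (_ : #|_| = 2 ^ #|I|)%N; last first.
  by rewrite -[in RHS]cardsT -card_powerset powersetT cardsT.
by rewrite -[a *+ _]mulr_natr natrX mulrCA mulVf ?mulr1// expf_neq0// pnatr_eq0.
Qed.

Lemma mean_ge0 f : (forall X, 0 <= f X) -> 0 <= mean f.
Proof.
by move=> f0; rewrite mulr_ge0 ?sumr_ge0// invr_ge0 exprn_ge0// ler0n.
Qed.

Lemma le_mean f g : (forall X, f X <= g X) -> mean f <= mean g.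
Proof.
move=> fg; rewrite -subr_ge0 -meanB; apply: mean_ge0 => X.
by rewrite subr_ge0.
Qed.

(** Lagrange's identity: averaging [(f X * g Y - f Y * g X) ^+ 2] over independent [X] and [Y] gives
    twice the gap between the two sides. *)
Lemma mean_cauchy_schwarz f g :
  mean (fun X => f X * g X) ^+ 2
    <= mean (fun X => f X ^+ 2) * mean (fun X => g X ^+ 2).
Proof.
have : 0 <= mean (fun X => mean (fun Y => (f X * g Y - f Y * g X) ^+ 2)).
  by apply: mean_ge0 => X; apply: mean_ge0 => Y; apply: sqr_ge0.
set a := mean (fun X => f X ^+ 2); set b := mean (fun X => f X * g X).
set c := mean (fun X => g X ^+ 2).
suff -> : mean (fun X => mean (fun Y => (f X * g Y - f Y * g X) ^+ 2)) =
  2 * (a * c - b ^+ 2) by rewrite pmulr_rge0// subr_ge0.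
have -> : mean (fun X => mean (fun Y => (f X * g Y - f Y * g X) ^+ 2)) =
    mean (fun X => f X ^+ 2 * c + a * g X ^+ 2 - f X * g X * (2 * b)).
  apply: eq_mean => X; rewrite -meanZ -meanZr -!meanZ -meanD -meanB.
  by apply: eq_mean => Y; ring.
by rewrite meanB meanD !meanZr meanZ; rewrite -/a -/b -/c; ring.
Qed.

(** * Bit flips, Walsh characters and Fourier inversion *)

Definition flip i X := if i \in X then X :\ i else i |: X.

Lemma in_flip i j X : (j \in flip i X) = (j == i) (+) (j \in X).
Proof.
rewrite /flip; case: ifP => iX; rewrite !inE; case: eqP => // ->;
  by rewrite iX.
Qed.

Lemma flipK i : involutive (flip i).
Proof. by move=> X; apply/setP => j; rewrite !in_flip addbA addbb. Qed.

Lemma mean_flip i f : mean (fun X => f (flip i X)) = mean f.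
Proof.
by rewrite /mean [in RHS](reindex_inj (inv_inj (flipK i))).
Qed.

(** The Walsh character: -1 to the power [#|S :&: X|]. *)
Definition chi S X : R := \prod_(i in S) (-1) ^+ (i \in X).

Lemma chiC S X : chi S X = chi X S.
Proof.
rewrite /chi big_mkcond [RHS]big_mkcond; apply: eq_bigr => i _.
by case: (i \in S); case: (i \in X).
Qed.

Lemma chi0 X : chi set0 X = 1.
Proof. by rewrite /chi big_set0. Qed.

Lemma chiU1 i S X : i \notin S -> chi (i |: S) X = (-1) ^+ (i \in X) * chi S X.
Proof. by move=> iS; rewrite /chi big_setU1. Qed.

Lemma chi_flip S i X : chi S (flip i X) = (-1) ^+ (i \in S) * chi S X.
Proof.
rewrite ![chi S _]chiC; case: (boolP (i \in X)) => iX.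
  rewrite /flip iX -[in RHS](setD1K iX) chiU1 ?setD11// mulrA -expr2.
  by rewrite sqrr_sign mul1r.
by rewrite /flip (negPf iX) chiU1.
Qed.

Lemma chi_sqr S X : chi S X ^+ 2 = 1.
Proof.
by rewrite /chi -prodrXl big1// => i _; rewrite sqrr_sign.
Qed.

Lemma mean_odd i f : (forall X, f (flip i X) = - f X) -> mean f = 0.
Proof.
move=> fN; have := mean_flip i f.
rewrite (eq_mean (g := fun X => -1 * f X)) => [|X]; last by rewrite fN mulN1r.
rewrite meanZ; lra.
Qed.

Lemma mean_chiM S T : mean (fun X => chi S X * chi T X) = (S == T)%:R.
Proof.
case: eqVneq => [->|neqST].
  by rewrite -[RHS](mean_cst 1); apply: eq_mean => X; rewrite -expr2 chi_sqr.
have [i iST] : exists i, (i \in S) != (i \in T).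
  apply/existsP; apply: contraNT neqST; rewrite negb_exists => /forallP h.
  by apply/eqP/setP => i; have := h i; rewrite negbK => /eqP.
apply: (@mean_odd i) => X; rewrite !chi_flip.
by move: iST; case: (i \in S); case: (i \in T) => //= _; ring.
Qed.

Lemma mean_chi S : mean (chi S) = (S == set0)%:R.
Proof.
by rewrite -mean_chiM; apply: eq_mean => X; rewrite chi0 mulr1.
Qed.

Definition coef f S := mean (fun X => f X * chi S X).

Lemma sum_chiM X Y :
  \sum_S chi S X * chi S Y = 2 ^+ #|I| * (X == Y)%:R.
Proof.
rewrite -mean_chiM /mean mulrA divff ?mul1r ?expf_neq0 ?pnatr_eq0//.
by apply: eq_bigr => S _; rewrite !(chiC S).
Qed.

(** By the dual orthogonality [sum_chiM], the kernel [\sum_S chi S Y * chi S X] is [2 ^+ #|I|] times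
    the point mass at [X]. *)
Lemma fourier_inversion f X : f X = \sum_S coef f S * chi S X.
Proof.
transitivity (mean (fun Y => f Y * \sum_S chi S Y * chi S X)).
  rewrite /mean (bigD1 X)//= sum_chiM eqxx mulr1.
  rewrite [X in _ + X]big1 ?addr0 => [|Y /negPf YX].
    by rewrite mulrCA mulVf ?mulr1// expf_neq0 ?pnatr_eq0.
  by rewrite sum_chiM YX !mulr0.
rewrite (eq_mean (g := fun Y => \sum_S f Y * chi S Y * chi S X)).
  by rewrite mean_sum; apply: eq_bigr => S _; rewrite meanZr.
by move=> Y; rewrite mulr_sumr; apply: eq_bigr => S _; rewrite mulrA.
Qed.

Lemma parseval f g : mean (fun X => f X * g X) = \sum_S coef f S * coef g S.
Proof.
have -> : mean (fun X => f X * g X) =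
    mean (fun X => \sum_S f X * chi S X * coef g S).
  apply: eq_mean => X; rewrite {1}(fourier_inversion g) mulr_sumr.
  by apply: eq_bigr => S _; ring.
by rewrite (mean_sum xpredT); apply: eq_bigr => S _; rewrite meanZr.
Qed.

Lemma coef_chi_sum (P : pred {set I}) (c : {set I} -> R) S :
  coef (fun X => \sum_(T | P T) c T * chi T X) S = if P S then c S else 0.
Proof.
rewrite /coef (eq_mean (g := fun X => \sum_(T | P T) c T * (chi T X * chi S X))).
  rewrite mean_sum; under eq_bigr do rewrite meanZ mean_chiM.
  case: ifP => PS.
    rewrite (bigD1 S)//= eqxx mulr1 big1 ?addr0// => T /andP[_ /negPf ->].
    by rewrite mulr0.
  by rewrite big1// => T PT; case: eqP => [e|]; rewrite ?mulr0//; rewrite e PS in PT.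
by move=> X; rewrite mulr_suml; apply: eq_bigr => T _; rewrite mulrA.
Qed.

Definition trunc (c : {set I} -> R) V d X :=
  \sum_(S : {set I} | (S \subset V) && (#|S| <= d)%N) c S * chi S X.

Lemma trunc_const c V d X : (V == set0) || (d == 0%N) ->
  trunc c V d X = c set0.
Proof.
move=> Vd; rewrite /trunc (bigD1 set0) ?sub0set ?cards0//= chi0 mulr1.
rewrite big1 ?addr0// => S /andP[/andP[SV Sd] S0]; case/orP: Vd => /eqP e.
  by rewrite e subset0 (negPf S0) in SV.
by rewrite e leqn0 cards_eq0 (negPf S0) in Sd.
Qed.

Lemma trunc_split c V d i X : i \in V ->
  trunc c V d.+1 X = trunc c (V :\ i) d.+1 X +
    (-1) ^+ (i \in X) * trunc (fun S => c (i |: S)) (V :\ i) d X.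
Proof.
move=> iV; rewrite /trunc (bigID (fun S : {set I} => i \in S))/= addrC.
congr (_ + _).
  by apply: eq_bigl => S; rewrite subsetD1 andbAC.
rewrite mulr_sumr (reindex_onto (fun S => i |: S) (fun S => S :\ i)) /=; last first.
  by move=> S /andP[_ iS]; rewrite setD1K.
apply: eq_big => [S|S].
  rewrite setU11 andbT subUset sub1set iV /= subsetD1.
  case: (boolP (i \in S)) => iS.
    rewrite andbF; apply/negP => /andP[_ /eqP e].
    by move: iS; rewrite -e setD11.
  by rewrite setU1K// eqxx !andbT cardsU1 iS add1n ltnS.
move=> /andP[_ /eqP e]; have iS : i \notin S by rewrite -e setD11.
by rewrite chiU1//; ring.
Qed.

Lemma trunc_flip c V d i X : i \notin V ->
  trunc c V d (flip i X) = trunc c V d X.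
Proof.
move=> iV; apply: eq_bigr => S /andP[SV _]; rewrite chi_flip.
by rewrite (negPf (contra (subsetP SV i) iV)) mul1r.
Qed.

Lemma mean_signM i f : (forall X, f (flip i X) = f X) ->
  mean (fun X => (-1) ^+ (i \in X) * f X) = 0.
Proof.
move=> fi; apply: (@mean_odd i) => X; rewrite fi in_flip eqxx /= signrN.
by rewrite mulNr.
Qed.

(** Induction on [#|V|]: by [trunc_split] the polynomial is [a + s * b] with [s] the sign of bit
    [i], on which [a] and [b] do not depend, so terms odd in [s] average to zero. The smaller degree
    of [b] gains a factor 9, which pays for the coefficient 6 of [a ^+ 2 * b ^+ 2]. *)
Lemma bonami c V d :
  mean (fun X => trunc c V d X ^+ 4)
    <= 9 ^+ d * mean (fun X => trunc c V d X ^+ 2) ^+ 2.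
Proof.
have [n] := ubnP #|V|; elim: n => // n IH in c V d *; rewrite ltnS => Vn.
case: (boolP ((V == set0) || (d == 0%N))) => [Vd|].
  rewrite (eq_mean (g := fun=> c set0 ^+ 4)) => [|X]; last first.
    by rewrite trunc_const.
  rewrite (eq_mean (f := fun X => _ ^+ 2) (g := fun=> c set0 ^+ 2)) => [|X]; last first.
    by rewrite trunc_const.
  rewrite !mean_cst -exprM ler_peMl ?exprn_even_ge0//.
  by rewrite exprn_ege1// ler1n.
rewrite negb_or; case: d => [|d]; first by rewrite andbF.
rewrite andbT => /set0Pn[i iV].
set a := trunc c (V :\ i) d.+1; set b := trunc (fun S => c (i |: S)) (V :\ i) d.
have ai X : a (flip i X) = a X by apply: trunc_flip; rewrite setD11.
have bi X : b (flip i X) = b X by apply: trunc_flip; rewrite setD11.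
have sgn2 X : ((-1) ^+ (i \in X) : R) ^+ 2 = 1 by rewrite sqrr_sign.
have card : (#|V :\ i| < n)%N by move: Vn; rewrite (cardsD1 i) iV.
have Ha := IH c _ d.+1 card; have Hb := IH (fun S => c (i |: S)) _ d card.
rewrite -/a -/b in Ha Hb.
have -> : mean (fun X => trunc c V d.+1 X ^+ 2) =
    mean (fun X => a X ^+ 2) + mean (fun X => b X ^+ 2).
  rewrite -[RHS]addr0 -(@mean_signM i (fun X => 2 * a X * b X)) => [|X]; last first.
    by rewrite ai bi.
  rewrite -!meanD; apply: eq_mean => X.
  rewrite (trunc_split _ _ _ iV) -/(a X) -/(b X).
  by move: (sgn2 X); set s := (-1) ^+ _ => s2; rewrite sqrrD exprMn s2; ring.
have -> : mean (fun X => trunc c V d.+1 X ^+ 4) =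
    mean (fun X => a X ^+ 4) + 6 * mean (fun X => a X ^+ 2 * b X ^+ 2)
    + mean (fun X => b X ^+ 4).
  rewrite -[RHS]addr0.
  rewrite -(@mean_signM i (fun X => 4 * a X ^+ 3 * b X + 4 * a X * b X ^+ 3)) => [|X]; last first.
    by rewrite ai bi.
  rewrite -meanZ -!meanD; apply: eq_mean => X.
  rewrite (trunc_split _ _ _ iV) -/(a X) -/(b X).
  move: (sgn2 X); set s := (-1) ^+ _ => s2.
  transitivity (a X ^+ 4 + 6 * (a X ^+ 2 * b X ^+ 2) * s ^+ 2
    + b X ^+ 4 * s ^+ 2 ^+ 2
    + s * (4 * a X ^+ 3 * b X + s ^+ 2 * (4 * a X * b X ^+ 3))); first by ring.
  by rewrite s2; ring.
have CS := mean_cauchy_schwarz (fun X => a X ^+ 2) (fun X => b X ^+ 2).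
rewrite (eq_mean (f := fun X => a X ^+ 2 ^+ 2) (g := fun X => a X ^+ 4)) in CS;
  last by move=> X /=; rewrite -exprM.
rewrite (eq_mean (f := fun X => b X ^+ 2 ^+ 2) (g := fun X => b X ^+ 4)) in CS;
  last by move=> X /=; rewrite -exprM.
move: Ha Hb CS.
have : 0 <= mean (fun X => a X ^+ 2 * b X ^+ 2).
  by apply: mean_ge0 => X; rewrite mulr_ge0 ?sqr_ge0.
have : 0 <= mean (fun X => a X ^+ 2) by apply: mean_ge0 => X; rewrite sqr_ge0.
have : 0 <= mean (fun X => b X ^+ 2) by apply: mean_ge0 => X; rewrite sqr_ge0.
have : 0 <= mean (fun X => a X ^+ 4) by apply: mean_ge0 => X; rewrite exprn_even_ge0.
have : 0 <= mean (fun X => b X ^+ 4) by apply: mean_ge0 => X; rewrite exprn_even_ge0.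
(* [u], [v] are the fourth moments of [b], [a]; [w], [x] their second moments; [y] is the mixed
   moment. *)
set u := mean _; set v := mean _; set w := mean _; set x := mean _; set y := mean _.
move=> u0 v0 w0 x0 y0 Hv Hu Hy.
have e : (9 : R) ^+ d = (3 ^+ d) ^+ 2 by rewrite exprAC; congr (_ ^+ _); ring.
rewrite exprS e in Hv *; rewrite e in Hu.
have : 0 < (3 : R) ^+ d by rewrite exprn_gt0.
set t := 3 ^+ d in Hu Hv *; move=> t0.
(* The 3 is the geometric mean of the 9 in [Hv] and the 1 in [Hu]; then 6 * 3 = 18 matches the cross
   term of [9 * (x + w) ^+ 2]. *)
have y2 : y <= 3 * t ^+ 2 * (x * w).
  rewrite -ler_sqr ?nnegrE//. 
    apply: (le_trans Hy); apply: (le_trans (ler_pM v0 u0 Hv Hu)).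
    by rewrite [leRHS](_ : _ = 9 * t ^+ 2 * x ^+ 2 * (t ^+ 2 * w ^+ 2))//; ring.
  by rewrite (mulr_ge0 (mulr_ge0 _ (sqr_ge0 t)) (mulr_ge0 x0 w0)).
apply: (le_trans (lerD (lerD Hv (ler_wpM2l (ler0n _ 6) y2)) Hu)).
rewrite -subr_ge0.
rewrite (_ : _ - _ = 8 * t ^+ 2 * w ^+ 2); last by ring.
by rewrite (mulr_ge0 (mulr_ge0 _ (sqr_ge0 t)) (sqr_ge0 w)).
Qed.

End Cube.

(** * Friedgut's junta theorem *)

Section Influence.
Variables (R : realFieldType) (I : finType) (f : {set I} -> bool).
Implicit Types (S X Y J : {set I}) (i : I) (d : nat).

Definition fcoef S : R := coef (fun X => (f X)%:R) S.

Definition infl i : R := mean (fun X => (f X != f (flip i X))%:R).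

Definition total_infl : R := \sum_i infl i.

(** Halving makes the Fourier coefficients equal to those of [f] at the sets containing [i], and 0
    elsewhere. *)
Definition deriv i X : R := ((f X)%:R - (f (flip i X))%:R) / 2.

Lemma infl_ge0 i : 0 <= infl i.
Proof. by apply: mean_ge0 => X; rewrite ler0n. Qed.

Lemma deriv_sqr i X : deriv i X ^+ 2 = (f X != f (flip i X))%:R / 4.
Proof. by rewrite /deriv; case: (f X); case: (f _) => /=; field. Qed.

Lemma coef_deriv i S : coef (deriv i) S = if i \in S then fcoef S else 0.
Proof.
have e : coef (fun X => (f (flip i X))%:R) S = (-1) ^+ (i \in S) * fcoef S.
  rewrite /coef -(mean_flip i) /fcoef /coef -meanZ; apply: eq_mean => X.
  by rewrite flipK chi_flip mulrCA.
transitivity ((fcoef S - (-1) ^+ (i \in S) * fcoef S) / 2).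
  rewrite -e /fcoef /coef -meanB -meanZr; apply: eq_mean => X.
  by rewrite /deriv; ring.
by case: (i \in S) => /=; field.
Qed.

Lemma infl_parseval i : \sum_(S : {set I} | i \in S) fcoef S ^+ 2 = infl i / 4.
Proof.
rewrite /infl -meanZr; under eq_mean do rewrite -deriv_sqr expr2.
rewrite parseval [in LHS]big_mkcond; apply: eq_bigr => S _.
by rewrite coef_deriv; case: ifP; rewrite ?mulr0.
Qed.

(* Two Cauchy-Schwarz steps play the role of Hoelder with exponents (4/3, 4):
   the derivative is supported on an event of probability [infl i], and the
   fourth moment of its truncation is controlled by [bonami]. *)
Lemma level_inequality i d :
  (\sum_(S : {set I} | (i \in S) && (#|S| <= d)%N) fcoef S ^+ 2) ^+ 2
    <= 9 ^+ d * infl i ^+ 3 / 16.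
Proof.
set W := \sum_(S : {set I} | _) _; set p := infl i.
pose c (S : {set I}) := if i \in S then fcoef S else 0.
pose L := trunc c setT d.
pose b X : R := (f X != f (flip i X))%:R.
have coefL S : coef L S = if (i \in S) && (#|S| <= d)%N then fcoef S else 0.
  by rewrite /L /trunc coef_chi_sum subsetT /= /c andbC; case: ifP => //= _; case: ifP.
have WL : W = mean (fun X => L X ^+ 2).
  under eq_mean do rewrite expr2.
  rewrite parseval /W big_mkcond; apply: eq_bigr => S _.
  by rewrite coefL; case: ifP; rewrite ?mulr0.
have WhL : W = mean (fun X => deriv i X * (b X * L X)).
  transitivity (mean (fun X => deriv i X * L X)).
    rewrite parseval /W big_mkcond; apply: eq_bigr => S _.
    by rewrite coefL coef_deriv; case: (i \in S); case: (_ <= d)%N; rewrite /= ?mulr0 ?mul0r.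
  apply: eq_mean => X; rewrite /deriv /b.
  by case: (f X); case: (f _) => /=; rewrite ?subrr ?mul0r ?mul1r.
have b2 X : b X ^+ 2 = b X by rewrite /b; case: (_ != _); rewrite ?expr1n ?expr0n.
pose Z := mean (fun X => b X * L X ^+ 2).
have W2 : W ^+ 2 <= p / 4 * Z.
  rewrite {1}WhL; apply: (le_trans (mean_cauchy_schwarz _ _)).
  rewrite -/(infl i) (eq_mean (g := fun X => b X / 4)) => [|X]; last exact: deriv_sqr.
  rewrite meanZr (eq_mean (f := fun X => (b X * L X) ^+ 2) (g := fun X => b X * L X ^+ 2)) //.
  by move=> X; rewrite exprMn b2.
have Z2 : Z ^+ 2 <= p * (9 ^+ d * W ^+ 2).
  apply: (le_trans (mean_cauchy_schwarz _ _)).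
  rewrite (eq_mean (f := fun X => b X ^+ 2) b2).
  rewrite (eq_mean (f := fun X => L X ^+ 2 ^+ 2) (g := fun X => L X ^+ 4)) => [|X]; last first.
    by rewrite -exprM.
  by rewrite ler_wpM2l ?infl_ge0// WL bonami.
have p0 : 0 <= p := infl_ge0 i.
have W4 : W ^+ 2 ^+ 2 <= 9 ^+ d * p ^+ 3 / 16 * W ^+ 2.
  apply: (@le_trans _ _ ((p / 4 * Z) ^+ 2)).
    by rewrite ler_sqr ?nnegrE ?sqr_ge0// (le_trans (sqr_ge0 W)).
  rewrite exprMn; apply: (le_trans (ler_wpM2l (sqr_ge0 _) Z2)).
  by rewrite le_eqVlt; apply/orP; left; apply/eqP; field.
(* [W4] is the claim multiplied by [W ^+ 2], so [W = 0] is treated apart. *)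
have [->|W0] := eqVneq W 0.
  by rewrite expr0n /= mulr_ge0 ?invr_ge0 ?ler0n// mulr_ge0 ?exprn_ge0.
rewrite -(ler_pM2r (x := W ^+ 2)) -?expr2 ?exprn_even_gt0//.
Qed.

Lemma card_fcoef : \sum_(S : {set I}) #|S|%:R * fcoef S ^+ 2 = total_infl / 4.
Proof.
rewrite /total_infl mulr_suml; under [RHS]eq_bigr do rewrite -infl_parseval.
rewrite [RHS](exchange_big_dep xpredT)//=; apply: eq_bigr => S _.
by rewrite sumr_const mulr_natl.
Qed.

(** The mass on sets larger than [d] is bounded by Markov's inequality from [card_fcoef]. A smaller
    set not inside [J] contains a bit of low influence, where [level_inequality] applies. *)
Lemma friedgut d : exists J,
  #|J|%:R <= total_infl * (9 ^+ d * d.+1%:R ^+ 2) /\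
  \sum_(S : {set I} | ~~ (S \subset J)) fcoef S ^+ 2 <= total_infl / (2 * d.+1%:R).
Proof.
pose q : R := 9 ^+ d * d.+1%:R ^+ 2.
have d0 : 0 < d.+1%:R :> R by rewrite ltr0n.
have q0 : 0 < q by rewrite mulr_gt0 ?exprn_gt0.
(* Each bit kept contributes at least 1 to [total_infl * q]; for the others, [infl i * q < 1] is
   what turns [level_inequality] into the bound [low]. *)
exists [set i | 1 <= infl i * q]; split.
  rewrite -/q /total_infl mulr_suml (bigID (fun i => 1 <= infl i * q))/=.
  rewrite -[leLHS]addr0; apply: lerD; last first.
    by apply: sumr_ge0 => i _; rewrite mulr_ge0 ?infl_ge0// ltW.
  rewrite cardsE -sum1_card natr_sum; apply: ler_sum => i.
  done.
set J := [set i | _].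
have high : \sum_(S : {set I} | (d < #|S|)%N) fcoef S ^+ 2 <= total_infl / 4 / d.+1%:R.
  rewrite ler_pdivlMr// -card_fcoef mulr_suml.
  rewrite [leRHS](bigID (fun S : {set I} => (d < #|S|)%N))/= -[leLHS]addr0.
  apply: lerD; last by apply: sumr_ge0 => S _; rewrite mulr_ge0 ?sqr_ge0.
  apply: ler_sum => S dS; rewrite mulrC ler_wpM2r ?sqr_ge0//.
  by rewrite ler_nat.
pose W i := \sum_(S : {set I} | (i \in S) && (#|S| <= d)%N) fcoef S ^+ 2.
have low i : i \notin J -> W i <= infl i / 4 / d.+1%:R.
  rewrite inE -ltNge => iJ; rewrite -ler_sqr ?nnegrE.
  - apply: (le_trans (level_inequality i d)).
    rewrite -subr_ge0.
    rewrite (_ : _ - _ = (infl i / 4 / d.+1%:R) ^+ 2 * (1 - infl i * q)).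
      by rewrite mulr_ge0 ?sqr_ge0// subr_ge0 ltW.
    by rewrite /q; move: d.+1%:R d0 => D D0; field; rewrite lt0r_neq0.
  - by apply: sumr_ge0 => S _; apply: sqr_ge0.
  - by rewrite !divr_ge0 ?infl_ge0 ?ler0n.
have -> : total_infl / (2 * d.+1%:R) =
    total_infl / 4 / d.+1%:R + total_infl / 4 / d.+1%:R.
  by move: d.+1%:R d0 => D D0; field; rewrite lt0r_neq0.
rewrite (bigID (fun S : {set I} => (d < #|S|)%N))/=; apply: lerD.
  apply: (le_trans _ high); rewrite [leRHS](bigID (fun S : {set I} => ~~ (S \subset J)))/=.
  rewrite -[leLHS]addr0; apply: lerD; last by apply: sumr_ge0 => S _; apply: sqr_ge0.
  by rewrite le_eqVlt; apply/orP; left; apply/eqP/eq_bigl => S; rewrite andbC.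
apply: (@le_trans _ _ (\sum_(i | i \notin J) W i)); last first.
  rewrite /total_infl !mulr_suml [leRHS](bigID (fun i => i \notin J))/= -[leLHS]addr0.
  apply: lerD; last by apply: sumr_ge0 => i _; rewrite !divr_ge0 ?infl_ge0 ?ler0n.
  exact: ler_sum.
(* Union bound: a small [S] not inside [J] is counted in [W i] for some [i \notin J]. *)
rewrite [leRHS](exchange_big_dep xpredT)//=.
rewrite [leRHS](bigID (fun S : {set I} =>
  ~~ (S \subset J) && ~~ (d < #|S|)%N))/=.
rewrite -[leLHS]addr0; apply: lerD; last first.
  by apply: sumr_ge0 => S _; apply: sumr_ge0 => i _; apply: sqr_ge0.
apply: ler_sum => S /andP[/subsetPn[i iS iJ]]; rewrite -leqNgt => Sd.
rewrite (bigD1 i) ?iJ ?iS ?Sd//= lerDl.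
by apply: sumr_ge0 => j _; apply: sqr_ge0.
Qed.

(** * Resampling the bits outside a set *)

Definition mix J X Y := (X :&: J) :|: (Y :\: J).

(* Since [f] is boolean, both squares in [(f X - f (mix J X Y)) ^+ 2] have mean
   [fcoef set0], which Parseval identifies with the total Fourier mass. *)
Lemma mean_mix J :
  mean (fun X => mean (fun Y => (f X != f (mix J X Y))%:R)) =
  2 * \sum_(S : {set I} | ~~ (S \subset J)) fcoef S ^+ 2.
Proof.
have chi_mix S X Y : chi R S (mix J X Y) = chi R (S :&: J) X * chi R (S :\: J) Y.
  rewrite /chi (big_setID J)/=; congr (_ * _); apply: eq_bigr => i;
    by rewrite !inE; case: (i \in J); rewrite ?andbF ?andbT ?orbF.
(* Averaging over [Y] kills the characters with a bit outside [J], leaving the conditional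
   expectation given the bits in [J]. *)
have mean_f_mix X : mean (fun Y => (f (mix J X Y))%:R) =
    \sum_(S : {set I}) (S \subset J)%:R * fcoef S * chi R S X.
  transitivity (mean (fun Y => \sum_S (fcoef S * chi R (S :&: J) X) * chi R (S :\: J) Y)).
    apply: eq_mean => Y; rewrite (fourier_inversion (fun X => (f X)%:R)).
    by apply: eq_bigr => S _; rewrite chi_mix mulrA.
  rewrite mean_sum; apply: eq_bigr => S _; rewrite meanZ mean_chi setD_eq0.
  case: (boolP (S \subset J)) => [/setIidPl ->|_]; first by rewrite mulr1 mul1r.
  by rewrite !(mulr0, mul0r).
have fE : mean (fun X => (f X)%:R) = fcoef set0.
  by apply: eq_mean => X; rewrite chi0 mulr1.
have fE2 : \sum_S fcoef S ^+ 2 = fcoef set0.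
  rewrite -fE; under eq_bigr do rewrite expr2.
  by rewrite -parseval; apply: eq_mean => X; case: (f X); rewrite ?mulr0 ?mulr1.
transitivity (mean (fun X => (f X)%:R + mean (R := R) (fun Y => (f (mix J X Y))%:R)
   - 2 * ((f X)%:R * mean (fun Y => (f (mix J X Y))%:R))) : R).
  apply: eq_mean => X; rewrite -[(f X)%:R in X in X + _](@mean_cst R I) -!meanZ -meanD -meanB.
  by apply: eq_mean => Y; case: (f X); case: (f _) => /=; ring.
rewrite meanB meanD meanZ fE.
have -> : mean (fun X => mean (fun Y => (f (mix J X Y))%:R)) = fcoef set0.
  under eq_mean do rewrite mean_f_mix.
  rewrite mean_sum (bigD1 set0)//= big1 ?addr0 => [|S S0].
    by rewrite meanZ mean_chi eqxx sub0set mulr1 mul1r.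
  by rewrite meanZ mean_chi (negPf S0) mulr0.
have -> : mean (fun X => (f X)%:R * mean (fun Y => (f (mix J X Y))%:R)) =
    \sum_(S : {set I} | S \subset J) fcoef S ^+ 2.
  under eq_mean do rewrite mean_f_mix mulr_sumr.
  rewrite mean_sum [RHS]big_mkcond; apply: eq_bigr => S _.
  under eq_mean do rewrite mulrCA.
  rewrite meanZ (_ : mean _ = fcoef S)// -mulrA -expr2.
  by case: ifP; rewrite ?(mul1r, mul0r).
rewrite -{1 2}fE2 (bigID (fun S : {set I} => S \subset J))/=; ring.
Qed.

(** Fewer sets escape [J'] than [J]. This allows enlarging the influential bits to whole blocks. *)
Lemma mixS J J' : J \subset J' ->
  mean (fun X => mean (fun Y => (f X != f (mix J' X Y))%:R)) <=
  2 * \sum_(S : {set I} | ~~ (S \subset J)) fcoef S ^+ 2.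
Proof.
move=> JJ'; rewrite mean_mix ler_wpM2l//.
rewrite [leRHS](bigID (fun S : {set I} => ~~ (S \subset J')))/= -[leLHS]addr0.
apply: lerD; last by apply: sumr_ge0 => S _; apply: sqr_ge0.
rewrite le_eqVlt; apply/orP; left; apply/eqP/eq_bigl => S.
by rewrite andb_idl//; apply: contra => /subset_trans; apply.
Qed.

End Influence.

(** * Binary encoding of the grid *)

Section BinaryValue.
Local Open Scope nat_scope.

Definition bval m (T : {set 'I_m}) : nat := \sum_(b in T) 2 ^ b.

Lemma bvalE m (T : {set 'I_m}) : bval T = \sum_(b < m) (b \in T) * 2 ^ b.
Proof.
by rewrite /bval big_mkcond; apply: eq_bigr => b _; case: (b \in T); rewrite ?mul1n.
Qed.

Lemma bval_lt m (T : {set 'I_m}) : bval T < 2 ^ m.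
Proof.
apply: (@leq_ltn_trans (\sum_(b < m) 2 ^ b)).
  by rewrite bvalE; apply: leq_sum => b _; case: (b \in T); rewrite ?mul1n.
elim: m {T} => [|m IH]; first by rewrite big_ord0.
by rewrite big_ord_recr /= expnS mul2n -addnn; rewrite ltn_add2r.
Qed.

(** Parity yields the lowest bit, then both sums are halved; indexing bits by [nat] lets the
    induction shift them. *)
Lemma bits_inj m (B C : nat -> bool) :
  \sum_(b < m) B b * 2 ^ b = \sum_(b < m) C b * 2 ^ b ->
  forall b, b < m -> B b = C b.
Proof.
elim: m => [//|m IH] in B C *; rewrite !big_ord_recl /= !muln1.
have split (D : nat -> bool) : \sum_(i < m) D (bump 0 i) * 2 ^ bump 0 i =
    (\sum_(i < m) D i.+1 * 2 ^ i).*2.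
  rewrite -muln2 big_distrl /=; apply: eq_bigr => i _.
  by rewrite /bump /= add1n expnS; lia.
rewrite !split => e.
have e0 : B 0 = C 0.
  by have := congr1 odd e; rewrite !oddD !odd_double !addbF !oddb.
case=> [//|b]; rewrite ltnS => bm.
apply: (IH (B \o succn) (C \o succn)) bm.
by move: e; rewrite e0 => /addnI/double_inj.
Qed.

Lemma bval_inj m : injective (@bval m).
Proof.
case: m => [|m] S T; first by move=> _; apply/setP => -[].
have bvalO (U : {set 'I_m.+1}) :
    bval U = \sum_(b < m.+1) (inord b \in U) * 2 ^ b.
  by rewrite bvalE; apply: eq_bigr => b _; rewrite inord_val.
rewrite !bvalO => e; apply/setP => b; rewrite -(inord_val b).
exact: (bits_inj (B := fun b => inord b \in S) (C := fun b => inord b \in T) e).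
Qed.

Lemma bval_flip m (b : 'I_m) (T : {set 'I_m}) :
  bval (flip b T) = 2 ^ b + bval T \/ bval T = 2 ^ b + bval (flip b T).
Proof.
rewrite /flip; case: (boolP (b \in T)) => bT; [right|left].
  by rewrite /bval (big_setD1 b).
by rewrite /bval big_setU1.
Qed.

Lemma card_interval N (a L : nat) : #|[set v : 'I_N | a <= v < a + L]| <= L.
Proof.
rewrite cardE -(size_map val) -[leqRHS](size_iota a).
apply: uniq_leq_size; first by rewrite map_inj_uniq ?enum_uniq//; apply: val_inj.
by move=> _ /mapP[v + ->]; rewrite mem_enum inE mem_iota.
Qed.

End BinaryValue.

(** * Blocks of bits and cells of values *)

Section Encoding.
Local Open Scope nat_scope.
Variables (k' n m : nat).
Let k := k'.+1.
Let bits : finType := ('I_n * 'I_m)%type.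
Implicit Types (X Y : {set bits}) (j : 'I_n) (b : 'I_m).

Definition block j X : {set 'I_m} := [set b | (j, b) \in X].

Lemma block_flip j b X i :
  block i (flip (j, b) X) = if i == j then flip b (block i X) else block i X.
Proof.
apply/setP => c; case: eqP => [->|/eqP/negPf ij]; rewrite !(in_flip, inE) //=.
  by rewrite xpair_eqE eqxx.
by rewrite xpair_eqE ij.
Qed.

Definition enc X : {ffun 'I_n -> 'I_(2 ^ m)} :=
  [ffun j => Ordinal (bval_lt (block j X))].

Lemma val_enc X j : enc X j = bval (block j X) :> nat.
Proof. by rewrite ffunE. Qed.

Lemma enc_inj : injective enc.
Proof.
move=> X Y /ffunP e; apply/setP => -[j b].
have /bval_inj/setP/(_ b) : bval (block j X) = bval (block j Y).
  by rewrite -!val_enc e.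
by rewrite !inE.
Qed.

Lemma card_bits_set : #|{set bits}| = #|{ffun 'I_n -> 'I_(2 ^ m)}|.
Proof.
rewrite card_ffun !card_ord -cardsT -powersetT card_powerset cardsT.
by rewrite card_prod !card_ord mulnC expnM.
Qed.

(** Independence of the blocks: [enc] is a bijection, being injective between types of equal
    cardinality. *)
Lemma card_enc (V : 'I_n -> {set 'I_(2 ^ m)}) :
  #|[set X | [forall j, enc X j \in V j]]| = \prod_j #|V j|.
Proof.
have [dec encK decK] : bijective enc.
  by apply: inj_card_bij enc_inj _; rewrite card_bits_set.
transitivity #|family (fun j => mem (V j))|.
  rewrite -(card_imset _ enc_inj); apply: eq_card => w.
  rewrite -{1}(decK w) mem_imset; last exact: enc_inj.
  by rewrite inE decK.
rewrite card_family foldrE big_map big_enum /=.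
by apply: eq_bigr.
Qed.

Let q := 2 ^ m %/ k.
Hypothesis q0 : 0 < q.

Definition cell (v : 'I_(2 ^ m)) : 'I_k := inord (minn (v %/ q) k').

Lemma val_cell v : cell v = minn (v %/ q) k' :> nat.
Proof. by rewrite inordK// ltnS geq_minr. Qed.

Lemma card_cell_ge (t : 'I_k) : q <= #|[set v | cell v == t]|.
Proof.
rewrite cardE -(size_map val) -[leqLHS](size_iota (t * q)).
apply: uniq_leq_size; first exact: iota_uniq.
move=> v; rewrite mem_iota => /andP[tv vt].
have vQ : v < 2 ^ m.
  apply: (leq_trans vt); rewrite -mulSnr (leq_trans _ (leq_divM _ k))//.
  by rewrite mulnC leq_mul2l ltn_ord orbT.
apply/mapP; exists (Ordinal vQ) => //.
rewrite mem_enum inE -val_eqE /= val_cell /=.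
have -> : v %/ q = t.
  by apply/eqP; rewrite eqn_leq leq_divRL// tv andbT -ltnS ltn_divLR// mulSnr.
by rewrite (minn_idPl _)// -ltnS ltn_ord.
Qed.

(** Only the last cell can exceed [q]: it absorbs the remainder of [2 ^ m] modulo [k], fewer than
    [k] values. *)
Lemma card_cell_le (t : 'I_k) : #|[set v | cell v == t]| <= q + k.
Proof.
apply: leq_trans (card_interval (2 ^ m) (t * q) (q + k)); apply: subset_leq_card.
apply/subsetP => v; rewrite !inE -val_eqE /= val_cell => /eqP e.
have tv : t <= v %/ q by rewrite -e geq_minl.
rewrite -leq_divRL// tv /=.
have vq : v < (v %/ q).+1 * q by rewrite -ltn_divLR.
have [vk|kv] := leqP k' (v %/ q).
  have {}e : t = k' :> nat by rewrite -e; apply/minn_idPr.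
  have := divn_eq (2 ^ m) k; have := ltn_pmod (2 ^ m) (ltn0Sn k').
  rewrite -/q -/k e; have := ltn_ord v; rewrite /k; nia.
by move: vq; rewrite (_ : v %/ q = t) ?mulSn; [lia | rewrite -e; lia].
Qed.

Definition proj X : grid k n := [ffun j => cell (enc X j)].

Lemma projE X j : proj X j = cell (enc X j).
Proof. by rewrite ffunE. Qed.

Lemma card_proj_ge (x : grid k n) : q ^ n <= #|[set X | proj X == x]|.
Proof.
rewrite (_ : [set X | _] =
    [set X | [forall j, enc X j \in [set v | cell v == x j]]]); last first.
  apply/setP => X; rewrite !inE; apply/eqP/forallP => [<- j|h].
    by rewrite inE projE.
  by apply/ffunP => j; rewrite projE; have := h j; rewrite inE => /eqP.
rewrite card_enc -[n in q ^ n]card_ord -prod_nat_const; apply: leq_prod => j _.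
exact: card_cell_ge.
Qed.

(** * Boundary edges crossed by a bit flip *)

Variable A : {set grid k n}.

Definition set_coord (u : grid k n) j (t : nat) : grid k n :=
  [ffun i => if i == j then inord t else u i].

Lemma set_coordE u j t i :
  set_coord u j t i = if i == j then inord t else u i.
Proof. by rewrite ffunE. Qed.

(** A boundary edge is recorded by its direction and lower endpoint; the bound by [k] keeps [inord]
    away from its default value. *)
Definition directed_boundary : {set 'I_n * grid k n} :=
  [set p : 'I_n * grid k n | ((p.2 p.1).+1 < k)
    && ((p.2 \in A) != (set_coord p.2 p.1 (p.2 p.1).+1 \in A))].

(** Tells the lower endpoint of an undirected edge from the upper one. *)
Definition weight (u : grid k n) := \sum_i (u i : nat).

Lemma weight_up (u : grid k n) j : (u j).+1 < k ->
  weight (set_coord u j (u j).+1) = (weight u).+1.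
Proof.
move=> ujk; rewrite /weight (bigD1 j)// [in RHS](bigD1 j)//= -addSn.
congr (_ + _); first by rewrite ffunE eqxx inordK.
by apply: eq_bigr => i /negPf ij; rewrite ffunE ij.
Qed.

Lemma card_directed_boundary : #|directed_boundary| <= #|edge_boundary A|.
Proof.
pose e (p : 'I_n * grid k n) := [set p.2; set_coord p.2 p.1 (p.2 p.1).+1].
rewrite -(card_in_imset (f := e)).
  apply: subset_leq_card; apply/subsetP => _ /imsetP[[j u] + ->].
  rewrite !inE /= => /andP[ujk uA]; apply/andP; split.
    apply/imset2P; exists u (set_coord u j (u j).+1) => //.
    rewrite inE /=; apply/existsP; exists j; rewrite ffunE eqxx inordK//.
    apply/andP; split; first by apply/eqP; lia.
    apply/forallP => i; apply/implyP => /negPf ij.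
    by rewrite ffunE ij.
  case: (boolP (u \in A)) uA => uA /= vA.
    apply/existsP; exists u; rewrite uA; apply/existsP.
    by exists (set_coord u j (u j).+1); rewrite inE vA /=.
  apply/existsP; exists (set_coord u j (u j).+1).
  move: vA; rewrite eq_sym eqbF_neg negbK => -> /=; apply/existsP.
  by exists u; rewrite inE uA /e /= setUC.
move=> [j u] [i w]; rewrite !inE /= => /andP[ujk _] /andP[wik _] /setP E.
have Wu := weight_up ujk; have Ww := weight_up wik.
(* Otherwise each of [u], [w] is the upper endpoint over the other, and each weight exceeds the
   other. *)
have uw : u = w.
  have := E u; have := E w; rewrite /e /= !inE !eqxx /=.
  move=> /orP[/eqP //|/eqP ew] /esym/orP[/eqP //|/eqP eu].
  by move: Wu Ww; rewrite -ew -eu; lia.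
subst w; congr pair; apply/eqP; apply: contraT => /negPf ji.
have := E (set_coord u j (u j).+1); rewrite /e /= !inE eqxx orbT => /esym/orP[]/eqP e1.
  by move: Wu; rewrite e1; lia.
have /(congr1 (fun f : grid k n => val (f j))) := e1.
by rewrite /= !ffunE eqxx ji inordK//; lia.
Qed.

(** Discrete intermediate values, used to find a boundary edge on a segment of the grid. *)
Lemma bool_jump (h : nat -> bool) a c : a <= c -> h a != h c ->
  exists t, [/\ a <= t, t < c & h t != h t.+1].
Proof.
elim: c => [|c IH]; first by rewrite leqn0 => /eqP ->; rewrite eqxx.
rewrite leq_eqVlt => /orP[/eqP ->|]; first by rewrite eqxx.
rewrite ltnS => ac; case: (eqVneq (h a) (h c)) => [->|hac] hacS.
  by exists c; rewrite ac ltnSn.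
by have [t [at_ tc ht]] := IH ac hac; exists t; rewrite at_ ltnW.
Qed.

(* The points whose letters off [j] agree with [u] and whose [j]-th value lies
   within [2 ^ b] of the threshold [(u j).+1 * q] separating [u j] from its
   successor. When the subtraction truncates, the interval only grows to the
   right. *)
Definition crossing j b (u : grid k n) : {set {set bits}} :=
  [set X | [forall i, enc X i \in
     (if i == j then [set v : 'I_(2 ^ m) |
        (u j).+1 * q - 2 ^ b <= v < (u j).+1 * q - 2 ^ b + 2 ^ b.+1]
      else [set v | cell v == u i])]].

Lemma card_crossing j b u : #|crossing j b u| <= 2 ^ b.+1 * (q + k) ^ n.-1.
Proof.
rewrite card_enc (bigD1 j)//= eqxx; apply: leq_mul; first exact: card_interval.
have -> : n.-1 = #|[pred i : 'I_n | i != j]|.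
  by rewrite -[in LHS](card_ord n) (cardD1 j) inE /=; apply: eq_card => i;
    rewrite !inE andbT.
rewrite -prod_nat_const; apply: leq_prod => i /negPf ->.
exact: card_cell_le.
Qed.

(** The flip moves only letter [j], so [bool_jump] finds a boundary edge between the two
    projections. Its threshold separates the two [j]-th values, which differ by [2 ^ b]. *)
Lemma cross_exists j b X :
  (proj X \in A) != (proj (flip (j, b) X) \in A) ->
  exists2 u, (j, u) \in directed_boundary & X \in crossing j b u.
Proof.
set X' := flip _ X => neq.
pose x := proj X; pose v : nat := enc X j; pose v' : nat := enc X' j.
have e i : i != j -> proj X' i = x i.
  move=> /negPf ij; rewrite /x !projE; congr cell; apply: val_inj => /=.
  by rewrite !ffunE /= block_flip ij.
have ex : x = set_coord x j (x j).
  by apply/ffunP => i; rewrite [RHS]ffunE; case: eqVneq => [->|//]; rewrite inord_val.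
have ex' : proj X' = set_coord x j (proj X' j).
  apply/ffunP => i; rewrite [RHS]ffunE; case: eqVneq => [->|]; first by rewrite inord_val.
  exact: e.
have dv : v' = 2 ^ b + v \/ v = 2 ^ b + v'.
  rewrite /v /v' !val_enc block_flip eqxx; exact: bval_flip.
have cross t : t < k' -> (set_coord x j t \in A) != (set_coord x j t.+1 \in A) ->
    (t.+1 * q <= v + 2 ^ b) -> v < t.+1 * q + 2 ^ b ->
    exists2 u, (j, u) \in directed_boundary & X \in crossing j b u.
  move=> tk tA lo hi; exists (set_coord x j t).
    have tk' : t < k by rewrite ltnS ltnW.
    rewrite inE /= ffunE eqxx inordK ?ltnS// tk /=.
    rewrite (_ : set_coord (set_coord _ _ _) _ _ = set_coord x j t.+1)//.
    by apply/ffunP => i; rewrite !ffunE; case: eqP.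
  rewrite inE; apply/forallP => i; case: eqP => [->|/eqP/negPf ij]; rewrite inE.
    rewrite set_coordE eqxx inordK; last by rewrite ltnS ltnW.
    rewrite -/v expnS.
    by apply/andP; split; lia.
  by rewrite set_coordE ij /x projE.
have cellE : x j = minn (v %/ q) k' :> nat by rewrite /x projE val_cell.
have cellE' : proj X' j = minn (v' %/ q) k' :> nat by rewrite /x projE val_cell.
rewrite -/x ex ex' in neq.
(* Below [k'] the cap in [cell] has no effect, so letters compare as values do with the
   threshold. *)
have vlt w t : t < k' -> minn (w %/ q) k' <= t -> w < t.+1 * q.
  by move=> tk h; rewrite -ltn_divLR//; lia.
have vge w t : t < minn (w %/ q) k' -> t.+1 * q <= w.
  by move=> h; rewrite -leq_divRL//; lia.
have [le|le] := leqP (x j) (proj X' j).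
  have [t [lo hi tA]] := bool_jump (h := fun t => set_coord x j t \in A) le neq.
  rewrite cellE in lo; rewrite cellE' in hi.
  have tk : t < k' by lia.
  have := vlt _ _ tk lo; have := vge _ _ hi.
  by move=> h1 h2; apply: (cross t tk tA); lia.
rewrite eq_sym in neq.
have [t [lo hi tA]] := bool_jump (h := fun t => set_coord x j t \in A) (ltnW le) neq.
rewrite cellE' in lo; rewrite cellE in hi.
have tk : t < k' by lia.
have := vlt _ _ tk lo; have := vge _ _ hi.
by move=> h1 h2; apply: (cross t tk tA); lia.
Qed.

(** Union bound over the boundary pairs of each direction; the interval lengths [2 ^ b.+1] form a
    geometric series, so [m] bits cost no factor [m]. *)
Lemma sum_flip_le :
  \sum_(i : bits) #|[set X | (proj X \in A) != (proj (flip i X) \in A)]| <=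
  #|edge_boundary A| * (2 ^ m.+1 * (q + k) ^ n.-1).
Proof.
apply: leq_trans (leq_mul card_directed_boundary (leqnn _)).
pose F j b := #|[set X | (proj X \in A) != (proj (flip (j, b) X) \in A)]|.
rewrite (eq_bigr (fun p : bits => F p.1 p.2)) => [|[]//].
rewrite -(pair_bigA _ F) /=.
rewrite -sum_nat_const; set c := 2 ^ _ * _.
have -> : \sum_(p in directed_boundary) c =
    \sum_j \sum_(u | (j, u) \in directed_boundary) c.
  by rewrite pair_big_dep; apply: eq_bigl => -[].
rewrite {}/c.
apply: leq_sum => j _.
apply: (@leq_trans (\sum_(b < m) \sum_(u | (j, u) \in directed_boundary)
   2 ^ b.+1 * (q + k) ^ n.-1)).
  apply: leq_sum => b _.
  apply: (@leq_trans (\sum_(u | (j, u) \in directed_boundary) #|crossing j b u|)).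
    apply: (@leq_trans #|\bigcup_(u | (j, u) \in directed_boundary) crossing j b u|).
      apply/subset_leq_card/subsetP => X; rewrite inE => /cross_exists[u uD Xu].
      by apply/bigcupP; exists u.
    elim/big_rec2: _ => [|u N S _ IH]; first by rewrite cards0.
    by rewrite (leq_trans (leq_card_setU _ _)) ?leq_add2l.
  by apply: leq_sum => u _; apply: card_crossing.
rewrite exchange_big; apply: leq_sum => u _ /=.
rewrite -big_distrl leq_mul2r; apply/orP; right.
elim: (m) => [|l IH]; first by rewrite big_ord0.
by rewrite big_ord_recr [leqRHS]expnS mul2n -addnn leq_add2r.
Qed.

End Encoding.

(** * Transfer to the uniform measure on the grid *)

Section Distortion.
Variable R : realFieldType.

Lemma bernoulli (x : R) n : 0 <= x <= 1 -> 1 - x *+ n <= (1 - x) ^+ n.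
Proof.
move=> /andP[x0 x1]; elim: n => [|n IH]; first by rewrite subr0.
rewrite exprS; apply: le_trans (ler_wpM2l _ IH); last by rewrite subr_ge0.
rewrite -subr_ge0 mulrSr (_ : _ - _ = x * (x *+ n)); last by ring.
by rewrite mulr_ge0// mulrn_wge0.
Qed.

Lemma exprn_1B_ge (x : R) n : 0 <= x -> x *+ n <= 1 / 2 -> 1 / 2 <= (1 - x) ^+ n.
Proof.
move=> x0 xn; case: n xn => [|n] xn; first by rewrite expr0; lra.
apply: le_trans (bernoulli _ _); first by lra.
rewrite x0/=; apply: (@le_trans _ _ (x *+ n.+1)); last by lra.
by rewrite mulrSr lerDr mulrn_wge0.
Qed.

(** Follows from the lower bound on [(1 - x) ^+ n], as the product of the two powers is at most
    1. *)
Lemma exprn_1D_le (x : R) n : 0 <= x -> x *+ n <= 1 / 2 -> (1 + x) ^+ n <= 2.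
Proof.
move=> x0 xn; have lo := exprn_1B_ge x0 xn.
have : (1 + x) ^+ n * (1 - x) ^+ n <= 1.
  case: n xn {lo} => [|n] xn; first by rewrite mulr1.
  have x1 : x <= 1.
    apply: (@le_trans _ _ (x *+ n.+1)); last by lra.
    by rewrite mulrSr lerDr mulrn_wge0.
  by rewrite -exprMn exprn_ile1//; nra.
have : 0 <= (1 + x) ^+ n by apply: exprn_ge0; lra.
nra.
Qed.

End Distortion.

Section Transfer.
Variables (R : realFieldType) (k' n m : nat).
Let k := k'.+1.
Let Q := (2 ^ m)%N.
Let q := (Q %/ k)%N.
Hypotheses (n0 : (0 < n)%N) (mQ : (2 * n * k ^ 2 <= Q)%N).
Let bits : finType := ('I_n * 'I_m)%type.
Variable A : {set grid k n}.

Definition pullback (X : {set bits}) := proj k' X \in A.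

Let q0 : (0 < q)%N.
Proof. by rewrite divn_gt0//; apply: leq_trans mQ; rewrite /k; nia. Qed.

Let Qk : Q%:R != 0 :> R /\ k%:R != 0 :> R.
Proof. by rewrite !pnatr_eq0 -lt0n expn_gt0. Qed.

Let cubeE : 2 ^+ #|bits| = Q%:R ^+ n :> R.
Proof. by rewrite card_prod !card_ord -!natrX mulnC expnM. Qed.

(** Rounding loses at most [k] values: [q * k / Q] is at least [1 - k / Q], and [mQ] makes the loss
    over [n] coordinates at most one half. *)
Lemma cell_weight_ge : (1 / 2) / k%:R ^+ n <= (q%:R / Q%:R) ^+ n :> R.
Proof.
have [Qn0 kn0] := Qk.
have k0 : 0 < k%:R ^+ n :> R by rewrite exprn_gt0// ltr0n.
have Q0 : 0 < Q%:R :> R by rewrite lt0r Qn0 ler0n.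
rewrite ler_pdivrMr// -exprMn.
apply: (@le_trans _ _ ((1 - k%:R / Q%:R) ^+ n)).
  apply: exprn_1B_ge; first by rewrite divr_ge0 ?ler0n.
  rewrite -[_ *+ n]mulr_natr mulrAC ler_pdivrMr// -natrM.
  have : (2 * (k * n) <= Q)%N by move: mQ; rewrite /k; nia.
  rewrite -(ler_nat R) natrM; lra.
have kq : (Q <= q * k + k)%N.
  by have := divn_eq Q k; have := ltn_pmod Q (ltn0Sn k'); rewrite -/q -/k; lia.
apply: lerXn2r; rewrite ?nnegrE.
- rewrite subr_ge0 ler_pdivrMr// mul1r ler_nat.
  by move: mQ; rewrite /k; nia.
- by rewrite mulr_ge0 ?divr_ge0 ?ler0n.
rewrite -(ler_pM2r Q0) mulrBl mul1r divfK// (_ : _ * Q%:R = q%:R * k%:R); last by field.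
by rewrite lerBlDr -natrM -natrD ler_nat.
Qed.

(** Here the relative excess of a cell over [Q / k] is at most [k ^ 2 / Q], hence the square in
    [mQ]. *)
Lemma cell_weight_le : ((q + k)%:R / Q%:R) ^+ n.-1 <= 2 / k%:R ^+ n.-1 :> R.
Proof.
have [Qn0 kn0] := Qk.
have k0 : 0 < k%:R ^+ n.-1 :> R by rewrite exprn_gt0// ltr0n.
have Q0 : 0 < Q%:R :> R by rewrite lt0r Qn0 ler0n.
rewrite ler_pdivlMr// -exprMn.
apply: (@le_trans _ _ ((1 + (k ^ 2)%:R / Q%:R) ^+ n.-1)); last first.
  apply: exprn_1D_le; first by rewrite divr_ge0 ?ler0n.
  rewrite -[_ *+ n.-1]mulr_natr mulrAC ler_pdivrMr// -natrM.
  have : (2 * (k ^ 2 * n.-1) <= Q)%N by move: mQ; rewrite /k; nia.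
  rewrite -(ler_nat R) natrM; lra.
apply: lerXn2r; rewrite ?nnegrE ?addr_ge0 ?mulr_ge0 ?invr_ge0 ?ler0n//.
rewrite -(ler_pM2r Q0) mulrDl mul1r divfK//.
rewrite (_ : _ * Q%:R = (q + k)%:R * k%:R); last by field.
rewrite -natrM -natrD ler_nat mulnDl expnS expn1.
by have := divn_eq Q k; rewrite -/q; lia.
Qed.

Lemma total_infl_le :
  total_infl R pullback <= 4 * (#|edge_boundary A|%:R / k%:R ^+ n.-1).
Proof.
have [Qn0 kn0] := Qk.
have Q0 : 0 < Q%:R :> R by rewrite lt0r Qn0 ler0n.
have := sum_flip_le q0 A; rewrite -(ler_nat R) natr_sum -/q -/k.
set B := #|edge_boundary A| => H.
have -> : total_infl R pullback = (Q%:R ^+ n)^-1 *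
    \sum_(i : bits) #|[set X | (proj k' X \in A) != (proj k' (flip i X) \in A)]|%:R.
  rewrite /total_infl mulr_sumr; apply: eq_bigr => i _.
  rewrite /infl /mean cubeE; congr (_ * _).
  rewrite -sum1_card natr_sum [RHS]big_mkcond /=; apply: eq_bigr => X _.
  by rewrite inE /pullback; case: (_ != _).
(* [2 ^ m.+1] is [2 * Q], and its [Q] cancels one of the [n] factors of the cube's size. The other
   factor 2 of the final 4 is [cell_weight_le]. *)
apply: (@le_trans _ _ (2 * B%:R * ((q + k)%:R / Q%:R) ^+ n.-1)).
  rewrite ler_pdivrMl ?exprn_gt0//; apply: (le_trans H).
  rewrite le_eqVlt; apply/orP; left; apply/eqP.
  rewrite !natrM expnS natrM -/Q natrX exprMn exprVn -[in RHS](prednK n0) exprS.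
  by field; rewrite expf_neq0.
rewrite (_ : 4 * _ = 2 * B%:R * (2 / k%:R ^+ n.-1)); last first.
  by field; rewrite expf_neq0.
by rewrite ler_wpM2l ?mulr_ge0 ?ler0n// cell_weight_le.
Qed.

(** Each fibre of [proj] has at least [q ^ n] points, so the uniform measure is at most twice the
    pushed one. *)
Lemma mean_proj_ge (h : grid k n -> R) : (forall x, 0 <= h x) ->
  (1 / 2) / k%:R ^+ n * \sum_x h x <= mean (fun X : {set bits} => h (proj k' X)).
Proof.
move=> h0; have [Qn0 _] := Qk.
have Q0 : 0 < Q%:R :> R by rewrite lt0r Qn0 ler0n.
apply: (le_trans (ler_wpM2r _ cell_weight_ge)); first exact: sumr_ge0.
rewrite /mean cubeE ler_pdivlMl ?exprn_gt0//.
rewrite (_ : _ * _ = q%:R ^+ n * \sum_x h x); last first.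
  by rewrite exprMn exprVn; field; rewrite expf_neq0.
rewrite mulr_sumr [leRHS](partition_big (fun X : {set bits} => proj k' X) xpredT)//=.
apply: ler_sum => x _; rewrite (eq_bigr (fun=> h x)) => [|X /eqP -> //].
rewrite sumr_const -[leRHS]mulr_natl ler_wpM2r// -natrX ler_nat.
apply: leq_trans (card_proj_ge q0 x) _.
by rewrite cardsE.
Qed.

Definition gmix (J : {set 'I_n}) (x z : grid k n) : grid k n :=
  [ffun j => if j \in J then x j else z j].

(** The resampled bits form whole blocks, so resampling commutes with the projection. *)
Lemma proj_mix (J : {set 'I_n}) (X Y : {set bits}) :
  proj k' (mix [set i | i.1 \in J] X Y) = gmix J (proj k' X) (proj k' Y).
Proof.
apply/ffunP => j; rewrite /gmix ffunE [RHS]ffunE !projE.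
case: ifP => jJ; rewrite ?projE; congr cell; apply: val_inj; rewrite /= !val_enc;
  congr bval; apply/setP => b; rewrite !inE /= jJ;
  by rewrite ?andbT ?andbF ?orbF.
Qed.

(** [mean_proj_ge] is applied once to [x] and once to [z], whence 4 = 2 * 2; some [z] is then no
    worse than average. *)
Lemma resample_le (J : {set 'I_n}) (e : R) :
  mean (fun X => mean (fun Y : {set bits} =>
    (pullback X != pullback (mix [set i | i.1 \in J] X Y))%:R)) <= e ->
  exists z, \sum_x ((x \in A) != (gmix J x z \in A))%:R <= 4 * e * k%:R ^+ n.
Proof.
move=> He; have [_ kn0] := Qk.
have k0 : 0 < k%:R ^+ n :> R by rewrite exprn_gt0// ltr0n.
pose G x z : R := ((x \in A) != (gmix J x z \in A))%:R.
have G0 x z : 0 <= G x z by rewrite ler0n.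
have S2 : \sum_z \sum_x G x z <= 4 * e * k%:R ^+ n * k%:R ^+ n.
  rewrite exchange_big /=.
  have c0 : 0 < (1 / 2) / k%:R ^+ n :> R by rewrite divr_gt0 ?divr_gt0 ?ltr01 ?ltr0n.
  rewrite -(ler_pM2l c0) -(ler_pM2l c0).
  rewrite [leRHS](_ : _ = e); last by field; rewrite lt0r_neq0.
  apply: le_trans He; rewrite mulr_sumr.
  apply: (le_trans (mean_proj_ge _)).
    by move=> x; rewrite mulr_ge0 ?(ltW c0)// sumr_ge0.
  apply: le_mean => X; apply: (le_trans (mean_proj_ge _)) => [//|].
  by apply: le_mean => Y; rewrite /pullback proj_mix.
have [z Hz|no] := pickP (fun z => \sum_x G x z <= 4 * e * k%:R ^+ n).
  by exists z.
suff : \sum_(z : grid k n) 4 * e * k%:R ^+ n < \sum_z \sum_x G x z.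
  by rewrite sumr_const card_ffun !card_ord -[ltLHS]mulr_natr natrX ltNge S2.
apply: ltr_sum => [|z _]; last by rewrite ltNge no.
(* Strictness of the sum needs a point of the grid. *)
by apply/hasP; exists [ffun=> ord0]; rewrite ?mem_index_enum.
Qed.

End Transfer.

(** * The junta and the choice of parameters *)

Lemma gmix_junta k' n (J : {set 'I_n}) (z : grid k'.+1 n) (A : {set grid k'.+1 n}) :
  is_junta #|J| (fun x => gmix J x z \in A).
Proof.
exists J; split=> // x y xy; congr (_ \in A); apply/ffunP => j.
by rewrite !ffunE; case: ifP => // /xy.
Qed.

(** The rate 6 is 4 + 2: [9 ^+ d] is at most [expR 4 ^+ d], and [d.+1%:R ^+ 2] at most
    [expR d%:R ^+ 2]. *)
Lemma junta_size_le (R : realType) (P : R) d :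
  0 <= P -> P * (9 ^+ d * d.+1%:R ^+ 2) <= expR (P + 6 * d%:R).
Proof.
move=> P0.
have e9 : 9 <= expR 4 :> R.
  have -> : expR 4 = expR 1 ^+ 4 :> R by rewrite -expRM_natl mulr1.
  have : 1 + 1 <= expR 1 :> R by apply: expR_ge1Dx.
  move=> /(lerXn2r 4); rewrite !nnegrE => /(_ _ _) h.
  by apply: le_trans (h _ _); rewrite ?expR_ge0 ?addr_ge0//; lra.
have ed : d.+1%:R <= expR d%:R :> R.
  by rewrite -natr1 addrC expR_ge1Dx.
have eP : P <= expR P by apply: le_trans (expR_ge1Dx P); lra.
have -> : expR (P + 6 * d%:R) = expR P * (expR 4 ^+ d * expR d%:R ^+ 2).
  rewrite -!expRM_natl -!expRD; congr expR; ring.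
by rewrite !ler_pM ?mulr_ge0 ?exprn_ge0 ?ler0n// lerXn2r// nnegrE ?ler0n ?expR_ge0.
Qed.

Theorem theorem3 (R : realType) :
  exists C1 : R, 0 < C1 /\
    forall (k n : nat) (A : {set grid k n}) (eps : R),
      (2 <= k)%N -> (1 <= n)%N -> 0 < eps ->
      exists (M : nat) (g : grid k n -> bool),
        is_junta M g /\
        l1norm (fun x : grid k n => (x \in A)%:R - (g x)%:R : R) <= eps /\
        M%:R <= expR (C1 * #|edge_boundary A|%:R / (k%:R ^+ (n - 1) * eps)).
Proof.
(* For [eps < 1], the exponent [P + 6 * d] with [d <= 4 * P / eps] is at most [25 * P / eps], and
   [P] is at most 4 times the normalized boundary. *)
exists 100; split=> // -[//|k'] n A eps _ n0 eps0.
have kn0 : 0 < k'.+1%:R ^+ n :> R by rewrite exprn_gt0// ltr0n.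
have [eps1|eps1] := leP 1 eps.
  exists 0%N, (fun=> false); split; first by exists set0; rewrite cards0.
  split; last exact: expR_ge0.
  apply: le_trans eps1; rewrite /l1norm ler_pdivrMl// mulr1.
  apply: (@le_trans _ _ (\sum_(x : grid k'.+1 n) 1)).
    by apply: ler_sum => x _; rewrite subr0; case: (x \in A); rewrite ?normr1 ?normr0.
  by rewrite sumr_const card_ffun !card_ord natrX.
(* Chosen for [m < 2 ^ m]; the final bound does not involve [m]. *)
pose m := (2 * n * k'.+1 ^ 2)%N.
have mQ : (2 * n * k'.+1 ^ 2 <= 2 ^ m)%N by apply/ltnW/ltn_expl.
pose f := pullback (m := m) A.
pose P := total_infl R f.
have P0 : 0 <= P by apply: sumr_ge0 => i _; apply: infl_ge0.
have P4 := total_infl_le R n0 mQ A; rewrite -/f -/P in P4.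
(* Then [P / d.+1] is below [eps / 4], leaving room for the factor 4 of [resample_le]. *)
pose d := Num.truncn (4 * P / eps).
have Pe0 : 0 <= 4 * P / eps by rewrite divr_ge0 ?mulr_ge0// ltW.
have dlt : 4 * P / eps < d.+1%:R by rewrite truncnS_gt.
have dge : d%:R <= 4 * P / eps by rewrite truncn_le.
have [J [cardJ tailJ]] := friedgut R f d.
(* The grid coordinates touched by [J], at most [#|J|] of them. *)
pose K := [set i.1 | i in J].
have JK : J \subset [set i | i.1 \in K].
  by apply/subsetP => i iJ; rewrite inE imset_f.
have Hmix : mean (fun X => mean (fun Y =>
    (f X != f (mix [set i | i.1 \in K] X Y))%:R)) <= eps / 4 :> R.
  apply: (le_trans (mixS R f JK)); rewrite -ler_pdivlMl//.
  apply: (le_trans tailJ); rewrite ler_pdivrMr ?mulr_gt0 ?ltr0n//.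
  move: dlt; rewrite ltr_pdivrMr// -/P => /ltW lt.
  rewrite (_ : 2^-1 * _ * _ = d.+1%:R * eps / 4); last by field.
  by rewrite ler_pdivlMr// mulrC.
have [z Hz] := resample_le n0 mQ Hmix.
exists #|K|, (fun x => gmix K x z \in A); split; first exact: gmix_junta.
split.
  rewrite /l1norm ler_pdivrMl//.
  rewrite (_ : 4 * (eps / 4) = eps) in Hz; last by field.
  rewrite mulrC; apply: le_trans Hz; apply: ler_sum => x _.
  by case: (x \in A); case: (_ \in A); rewrite ?subrr ?subr0 ?sub0r ?normrN ?normr0 ?normr1.
apply: (@le_trans _ _ (#|J|%:R)); first by rewrite ler_nat leq_imset_card.
apply: (le_trans cardJ); apply: (le_trans (junta_size_le _ P0)).
rewrite ler_expR subn1.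
set B := #|_|%:R in P4 *; set D := _ ^+ n.-1 in P4 *.
have -> : 100 * B / (D * eps) = 100 * (B / D) / eps by rewrite invfM !mulrA.
rewrite ler_pdivlMr// mulrDl -mulrA.
have Peps : P * eps <= P by rewrite ler_piMr// ltW.
have deps : d%:R * eps <= 4 * P by rewrite -ler_pdivlMr.
move: (P * eps) (d%:R * eps) (B / D) (P) Peps deps P4 => x y w p; clear; lra.
Qed.
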